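(* Let $k\ge0$ be an integer, $\bar E,\bar A\in\{0,\times,\otimes\}^{n\times n}$, and let $W^C\in\mathbb R_+^{(k+1)n\times n}$ be a homogeneous sensing cost. The structural matrix $\bar C^*\in\{0,\times\}^{(k+1)n\times n}$ is a solution to $\mathcal P_2^0$ with $\bar E,\bar A$ and homogeneous sensing cost $W^C$ if and only if $(\bar C^* )^\intercal$ is a solution to $\mathcal P_1^0$ with $\bar E^\intercal$ and $\bar A^\intercal$ and homogeneous actuation cost $W^B=(W^C)^\intercal$.
   Context: $\bar X\in\{0,\times,\otimes\}^{a\times b}$ defines the class $[\bar X]$ of real $a\times b$ matrices $X$ with $X_{ij}=0$ if $\bar X_{ij}=0$, $X_{ij}\neq0$ if $\bar X_{ij}=\times$, $X_{ij}\in\mathbb R$ arbitrary if $\bar X_{ij}=\otimes$. For $\bar E,\bar A\in\{0,\times,\otimes\}^{n\times n}$, $([\bar E],[\bar A])^\star=\{(E,A)\in[\bar E]\times[\bar A]:\det(A-\lambda E)\not\equiv0\}$. For a regular descriptor system $E\dot x=Ax+Bu$, $y=Cx$, $(E,A,B)$ is controllable (R-controllable) if $\mathrm{rank}[A-\lambda E\ \ B]=n$ for all $\lambda\in\mathbb C$, and $(E,A,C)$ is observable if $\mathrm{rank}[A^\intercal-\lambda E^\intercal\ \ C^\intercal]^\intercal=n$ for all $\lambda\in\mathbb C$. $(\bar E,\bar A,\bar B)$ is selective strong structural controllable, SSSC (resp. $(\bar E,\bar A,\bar C)$ is selective strong structural observable, SSSO) if $(E,A,B)$ is controllable (resp. $(E,A,C)$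 is observable) for all $(E,A)\in([\bar E],[\bar A])^\star$ and all $B\in[\bar B]$ (resp. $C\in[\bar C]$). For a cost matrix $W$, $\|\bar X\|_W=\sum_{(i,j):\bar X_{ij}=\times}W_{ij}$; a cost is homogeneous if all its entries equal one positive constant. $\mathcal P_1^0$ (with $\bar E,\bar A,W^B$): minimize $\|\bar B\|_{W^B}$ over $\bar B\in\{0,\times\}^{n\times(k+1)n}$ such that $(\bar E,\bar A,\bar B)$ is SSSC, with homogeneous $W^B$. $\mathcal P_2^0$ (with $\bar E,\bar A,W^C$): minimize $\|\bar C\|_{W^C}$ over $\bar C\in\{0,\times\}^{(k+1)n\times n}$ such that $(\bar E,\bar A,\bar C)$ is SSSO, with homogeneous $W^C$. *)

(* Defs.v *)
From HB Require Import structures.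
From mathcomp Require Import all_boot all_order all_algebra.
From mathcomp Require Import reals complex.

Set Implicit Arguments.
Unset Strict Implicit.
Unset Printing Implicit Defensive.

Import Order.TTheory GRing.Theory Num.Theory.
Local Open Scope ring_scope.
Local Open Scope complex_scope.

(* 0, × and ⊗ respectively. *)
Inductive sym : Type := Zero | Cross | Any.

Definition is_cross (s : sym) : bool := if s is Cross then true else false.

Definition in_class (R : realType) (a b : nat)
    (P : 'M[sym]_(a, b)) (X : 'M[R]_(a, b)) : Prop :=
  forall i j,
    match P i j with
    | Zero => X i j = 0
    | Cross => X i j != 0
    | Any => True
    end.

Definition zero_cross (a b : nat) (P : 'M[sym]_(a, b)) : Prop :=
  forall i j, P i j = Zero \/ P i j = Cross.

Definition cmx (R : realType) (a b : nat) (X : 'M[R]_(a, b)) : 'M[R[i]]_(a, b) :=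
  map_mx (real_complex R) X.

Definition pencil (R : realType) (n : nat) (E A : 'M[R]_n) (lambda : R[i]) :
    'M[R[i]]_n :=
  cmx A - lambda *: cmx E.

Definition regular (R : realType) (n : nat) (E A : 'M[R]_n) : Prop :=
  ~ (forall lambda : R[i], \det (pencil E A lambda) = 0).

(* (E, A) belongs to ([Ebar], [Abar])^*. *)
Definition regular_class (R : realType) (n : nat) (Ebar Abar : 'M[sym]_n)
    (E A : 'M[R]_n) : Prop :=
  [/\ in_class Ebar E, in_class Abar A & regular E A].

(* R-controllability and R-observability: finite lambda only, no rank condition
   at infinity; meant for regular (E, A). *)
Definition controllable (R : realType) (n m : nat)
    (E A : 'M[R]_n) (B : 'M[R]_(n, m)) : Prop :=
  forall lambda : R[i], \rank (row_mx (pencil E A lambda) (cmx B)) = n.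

Definition observable (R : realType) (n p : nat)
    (E A : 'M[R]_n) (C : 'M[R]_(p, n)) : Prop :=
  forall lambda : R[i],
    \rank (row_mx (pencil E^T A^T lambda) (cmx C^T))^T = n.

Definition SSSC (R : realType) (n m : nat)
    (Ebar Abar : 'M[sym]_n) (Bbar : 'M[sym]_(n, m)) : Prop :=
  forall (E A : 'M[R]_n) (B : 'M[R]_(n, m)),
    regular_class Ebar Abar E A -> in_class Bbar B -> controllable E A B.

Definition SSSO (R : realType) (n p : nat)
    (Ebar Abar : 'M[sym]_n) (Cbar : 'M[sym]_(p, n)) : Prop :=
  forall (E A : 'M[R]_n) (C : 'M[R]_(p, n)),
    regular_class Ebar Abar E A -> in_class Cbar C -> observable E A C.

Definition cost (R : realType) (a b : nat)
    (W : 'M[R]_(a, b)) (P : 'M[sym]_(a, b)) : R :=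
  \sum_(ij : 'I_a * 'I_b | is_cross (P ij.1 ij.2)) W ij.1 ij.2.

Definition homogeneous (R : realType) (a b : nat) (W : 'M[R]_(a, b)) : Prop :=
  exists2 c : R, 0 < c & forall i j, W i j = c.

(* Bbar solves P_1^0 with data Ebar, Abar, W; homogeneity of W is part of the
   problem. *)
Definition P10_solution (R : realType) (n k : nat) (Ebar Abar : 'M[sym]_n)
    (W : 'M[R]_(n, k.+1 * n)) (Bbar : 'M[sym]_(n, k.+1 * n)) : Prop :=
  [/\ homogeneous W,
      zero_cross Bbar,
      SSSC R Ebar Abar Bbar
    & forall B' : 'M[sym]_(n, k.+1 * n),
        zero_cross B' -> SSSC R Ebar Abar B' -> cost W Bbar <= cost W B'].

(* Cbar solves P_2^0 with data Ebar, Abar, W. *)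
Definition P20_solution (R : realType) (n k : nat) (Ebar Abar : 'M[sym]_n)
    (W : 'M[R]_(k.+1 * n, n)) (Cbar : 'M[sym]_(k.+1 * n, n)) : Prop :=
  [/\ homogeneous W,
      zero_cross Cbar,
      SSSO R Ebar Abar Cbar
    & forall C' : 'M[sym]_(k.+1 * n, n),
        zero_cross C' -> SSSO R Ebar Abar C' -> cost W Cbar <= cost W C'].

(* Main.v *)
Require Import Defs.
From HB Require Import structures.
From mathcomp Require Import all_boot all_order all_algebra.
From mathcomp Require Import reals complex.

Set Implicit Arguments.
Unset Strict Implicit.
Unset Printing Implicit Defensive.

Import Order.TTheory GRing.Theory Num.Theory.
Local Open Scope ring_scope.

(* Transposition maps each class [P] onto [P^T], preserves the regularity of a
   pencil and the cost, and exchanges the observability and controllability rank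
   conditions; it is therefore a cost-preserving bijection between the feasible
   points of the two problems. *)

Lemma in_class_tr (R : realType) (a b : nat) (P : 'M[sym]_(a, b))
    (X : 'M[R]_(a, b)) :
  in_class P^T X^T <-> in_class P X.
Proof. by split=> h i j; have := h j i; rewrite !mxE. Qed.

Lemma zero_cross_tr (a b : nat) (P : 'M[sym]_(a, b)) :
  zero_cross P^T <-> zero_cross P.
Proof. by split=> h i j; have := h j i; rewrite mxE. Qed.

Lemma homogeneous_tr (R : realType) (a b : nat) (W : 'M[R]_(a, b)) :
  homogeneous W^T <-> homogeneous W.
Proof.
by split=> -[c c_gt0 Wc]; exists c => // i j; have := Wc j i; rewrite mxE.
Qed.

Lemma cost_tr (R : realType) (a b : nat) (W : 'M[R]_(a, b))
    (P : 'M[sym]_(a, b)) :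
  cost W^T P^T = cost W P.
Proof.
(* The index pairs of the transpose are reindexed by the coordinate swap, whose inverse is again a
   swap. *)
rewrite /cost (reindex (fun ij : 'I_a * 'I_b => (ij.2, ij.1))) /=; last first.
  by exists (fun ji => (ji.2, ji.1)) => -[].
by apply: eq_big => [ij|ij _]; rewrite !mxE.
Qed.

Lemma pencil_tr (R : realType) (n : nat) (E A : 'M[R]_n) (lambda : R[i]) :
  pencil E^T A^T lambda = (pencil E A lambda)^T.
Proof. by apply/matrixP=> i j; rewrite !mxE. Qed.

Lemma regular_tr (R : realType) (n : nat) (E A : 'M[R]_n) :
  regular E^T A^T <-> regular E A.
Proof.
by split=> reg det0; apply: reg => lambda; have := det0 lambda;
  rewrite pencil_tr det_tr.
Qed.

Lemma regular_class_tr (R : realType) (n : nat) (Ebar Abar : 'M[sym]_n)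
    (E A : 'M[R]_n) :
  regular_class Ebar^T Abar^T E^T A^T <-> regular_class Ebar Abar E A.
Proof.
by split=> -[hE hA hreg]; split; first [exact/in_class_tr | exact/regular_tr].
Qed.

(** The matrix tested by [observable] is the transpose of the one tested by [controllable] on
    transposed data, and rank is invariant under transposition. *)
Lemma controllable_tr (R : realType) (n p : nat) (E A : 'M[R]_n)
    (C : 'M[R]_(p, n)) :
  controllable E^T A^T C^T <-> observable E A C.
Proof. by split=> h lambda; have := h lambda; rewrite mxrank_tr. Qed.

Lemma SSSC_tr (R : realType) (n p : nat) (Ebar Abar : 'M[sym]_n)
    (Cbar : 'M[sym]_(p, n)) :
  SSSC R Ebar^T Abar^T Cbar^T <-> SSSO R Ebar Abar Cbar.
Proof.
split=> [hC E A C hEA hCbar | hO E A B].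
  by apply/controllable_tr/hC; [exact/regular_class_tr | exact/in_class_tr].
(* As transposition is an involution, arbitrary [E], [A], [B] are transposes, so [hO] applies to
   [E^T], [A^T], [B^T]. *)
rewrite -[E]trmxK -[A]trmxK -[B]trmxK => /regular_class_tr hEA /in_class_tr hB.
exact/controllable_tr/hO.
Qed.

Theorem theorem4 (R : realType) (n k : nat) (Ebar Abar : 'M[sym]_n)
    (WC : 'M[R]_(k.+1 * n, n))
    (WC_ge0 : forall i j, 0 <= WC i j)
    (WC_hom : homogeneous WC)
    (Cbar : 'M[sym]_(k.+1 * n, n))
    (Cbar_0x : zero_cross Cbar) :
  P20_solution Ebar Abar WC Cbar <->
  P10_solution Ebar^T Abar^T WC^T Cbar^T.
Proof.
split=> -[_ _ feas opt].
  split; [exact/homogeneous_tr | exact/zero_cross_tr | exact/SSSC_tr |].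
  (* Any competitor [B'] is the transpose of [B'^T], which is feasible for the sensing problem. *)
  move=> B'; rewrite -[B']trmxK => /zero_cross_tr B'_0x /SSSC_tr B'_feas.
  by rewrite !cost_tr; exact: opt.
split=> //; first exact/SSSC_tr.
(* Conversely, [C'] is compared through its transpose, a feasible actuation pattern of equal
   cost. *)
move=> C' C'_0x C'_feas; rewrite -(cost_tr WC Cbar) -(cost_tr WC C').
by apply: opt; [exact/zero_cross_tr | exact/SSSC_tr].
Qed.
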